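(* Let $M$ be a loopless matroid and $N$ an adjoint of $M$. If $N=N_1\oplus N_2$ for matroids $N_1,N_2$, then there are submatroids $M_1,M_2$ of $M$ such that $M=M_1\oplus M_2$ and $N_i$ is an adjoint of $M_i$ for $i=1,2$.
   Context: All matroids are finite and nonempty (in particular $N_1,N_2$ are nonempty). $\mathcal{L}(M)$ is the lattice of flats of $M$. A matroid $N$ is an adjoint of $M$ if $r(N)=r(M)$ and there is an injective order-reversing map $\phi:\mathcal{L}(M)\to\mathcal{L}(N)$ sending the coatoms of $\mathcal{L}(M)$ (the hyperplanes of $M$) bijectively onto the atoms of $\mathcal{L}(N)$. $\oplus$ denotes direct sum of matroids.
   Formalization: The submatroids M_1, M_2 may be empty: if N_i consists only of loops then M_i must be empty (e.g. M=U_{1,1}, N=U_{1,1}⊕U_{0,1}); whenever r(N_i)>0, M_i is nonempty because r(M_i)=r(N_i). *)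

(* Defs.v *)
From mathcomp Require Import all_boot.

Set Implicit Arguments.
Unset Strict Implicit.
Unset Printing Implicit Defensive.

(* A matroid whose ground set is a subset of the carrier T.  The empty ground
   set is not excluded: when a direct summand of an adjoint of a loopless
   matroid consists of loops only, the corresponding summand is empty. *)
Record matroid (T : finType) := Matroid {
  ground : {set T};
  indep : {set {set T}};
  indep_ground : forall I : {set T}, I \in indep -> I \subset ground;
  indep0 : set0 \in indep;
  indepS : forall I J : {set T}, J \in indep -> I \subset J -> I \in indep;
  indep_augment : forall I J : {set T}, I \in indep -> J \in indep -> #|I| < #|J| ->
    exists2 x, x \in J :\: I & x |: I \in indep
}.

Section MatroidNotions.
Variable T : finType.
Implicit Types (M : matroid T) (A F : {set T}).

Definition nonempty M := ground M != set0.

Definition loopless M := forall x, x \in ground M -> [set x] \in indep M.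

Definition rank_of M A := \max_(I in indep M | I \subset A) #|I|.

Definition mrank M := rank_of M (ground M).

Definition mclosure M A :=
  [set x in ground M | rank_of M (x |: A) == rank_of M A].

(* The lattice of flats, ordered by inclusion: its top is [ground M] and its
   bottom is [mclosure M set0], the set of loops. *)
Definition flats M := [set F : {set T} | (F \subset ground M) && (mclosure M F == F)].

Definition coatoms M :=
  [set F | maxset [pred G : {set T} | (G \in flats M) && (G \proper ground M)] F].

Definition atoms M :=
  [set F | minset [pred G : {set T} | (G \in flats M) && (mclosure M set0 \proper G)] F].

Definition submatroid M' M :=
  ground M' \subset ground M /\
  indep M' = [set I in indep M | I \subset ground M'].

Definition is_direct_sum M M1 M2 :=
  [/\ [disjoint ground M1 & ground M2],
      ground M = ground M1 :|: ground M2 &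
      indep M = [set I1 :|: I2 | I1 in indep M1, I2 in indep M2]].

End MatroidNotions.

(* Only the values of phi on flats matter.  Bijectivity from the coatoms onto
   the atoms is the image equation together with injectivity on all flats. *)
Definition adjoint (T U : finType) (M : matroid T) (N : matroid U) :=
  mrank N = mrank M /\
  exists phi : {set T} -> {set U},
    [/\ forall F, F \in flats M -> phi F \in flats N,
        {in flats M &, injective phi},
        {in flats M &, forall F G : {set T}, F \subset G -> phi G \subset phi F} &
        phi @: coatoms M = atoms N].

Lemma adjoint_nonempty (T U : finType) (M : matroid T) (N : matroid U) :
  adjoint M N -> 0 < mrank N -> nonempty M.
Proof.
case=> -> _; rewrite /nonempty /mrank; apply: contraTneq => ->.
rewrite -leqNgt; apply/bigmax_leqP => I /andP[_].
by rewrite subset0 => /eqP->; rewrite cards0.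
Qed.

(* Main.v *)
(** Let [phi] be the adjoint map and [r] the common rank. Images of maximal
    chains show that [phi F] has rank [r - rank F]; a rank count then shows that
    [phi] reflects the order, so that [phi] turns joins into meets, because the
    atoms of [N] are images of hyperplanes of [M]. For a point [x] of [M], the
    flat [phi (cl x)] is a hyperplane of [N = N1 + N2], so it contains exactly
    one of [ground N1] and [ground N2]. Let [E1] (resp. [E2]) be the set of
    points [x] whose hyperplane contains [ground N2] (resp. [ground N1]). The meet
    formula gives [rank Ei <= rank Ni]; since [E1] and [E2] partition [M] and
    the ranks of the [Ni] add up to [r], [M] is the direct sum of its
    restrictions to [E1] and [E2], and [F |-> phi F :&: ground Ni] makes [Ni] an
    adjoint of the restriction to [Ei]. *)

Require Import Defs.
From mathcomp Require Import all_boot.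
From mathcomp Require Import zify.

Set Implicit Arguments.
Unset Strict Implicit.
Unset Printing Implicit Defensive.

(* Boolean facts about sets left in the context make [lia] extremely slow. *)
Ltac rank_lia :=
  repeat match goal with
  | H : is_true (_ \in _) |- _ => clear H
  | H : is_true (_ \subset _) |- _ => clear H
  | H : is_true (~~ (_ \in _)) |- _ => clear H
  | H : is_true (~~ (_ \subset _)) |- _ => clear H
  | H : _ = _ :> {set _} |- _ => clear H
  | H : (forall _, _) |- _ => clear H
  end; lia.

(** * Rank and closure *)

Section Rank.
Variables (T : finType) (M : matroid T).
Implicit Types (A B C F G I J : {set T}) (x y : T).

Lemma leq_card_rank I A : I \in indep M -> I \subset A -> #|I| <= rank_of M A.
Proof. by move=> iI sIA; apply: leq_bigmax_cond; rewrite iI. Qed.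

Lemma rank_basis A :
  exists B, [/\ B \in indep M, B \subset A & #|B| = rank_of M A].
Proof.
pose D := [pred I : {set T} | (I \in indep M) && (I \subset A)].
have D_gt0 : 0 < #|D| by apply/card_gt0P; exists set0; rewrite inE /= indep0 sub0set.
have [B /andP[iB sBA] eqB] := eq_bigmax_cond (fun I : {set T} => #|I|) D_gt0.
by exists B; split=> //; rewrite -eqB; apply: eq_bigl => I.
Qed.

Lemma rankS A B : A \subset B -> rank_of M A <= rank_of M B.
Proof.
move=> sAB; have [I [iI sIA <-]] := rank_basis A.
exact: leq_card_rank iI (subset_trans sIA sAB).
Qed.

Lemma rank_le_card A : rank_of M A <= #|A|.
Proof. by have [I [_ sIA <-]] := rank_basis A; exact: subset_leq_card. Qed.

Lemma rank0 : rank_of M set0 = 0.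
Proof. by apply/eqP; rewrite -leqn0 -(cards0 T) rank_le_card. Qed.

Lemma rank_indep I : I \in indep M -> rank_of M I = #|I|.
Proof. by move=> iI; apply/eqP; rewrite eqn_leq rank_le_card leq_card_rank. Qed.

Lemma indep_rank I : #|I| <= rank_of M I -> I \in indep M.
Proof.
have [J [iJ sJI <-]] := rank_basis I => le_IJ.
by have /eqP <- : J == I by rewrite eqEcard sJI.
Qed.

(** Augmenting [I] from a basis of [A] stays inside [A]; the induction is on the number of elements
    still missing. *)
Lemma basis_extend I A : I \in indep M -> I \subset A ->
  exists B, [/\ B \in indep M, I \subset B, B \subset A & #|B| = rank_of M A].
Proof.
have [n] := ubnP (rank_of M A - #|I|); elim: n I => // n IHn I le_n iI sIA.
have [le_AI | lt_IA] := leqP (rank_of M A) #|I|.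
  by exists I; split=> //; apply/eqP; rewrite eqn_leq le_AI leq_card_rank.
have [J [iJ sJA cJ]] := rank_basis A.
have [|x /setDP[xJ xI] ixI] := indep_augment iI iJ; first by rewrite cJ.
have [||B [iB sIB sBA cB]] := IHn (x |: I) _ ixI.
- by rewrite cardsU1 xI; rank_lia.
- by rewrite subUset sub1set sIA (subsetP sJA).
by exists B; split=> //; apply: subset_trans sIB; rewrite subsetUr.
Qed.

Lemma rank_setU1_le x A : rank_of M (x |: A) <= (rank_of M A).+1.
Proof.
have [J [iJ sJA <-]] := rank_basis (x |: A).
have sJ : J :\ x \subset A.
  by apply/subsetP => y /setD1P[yx /(subsetP sJA)/setU1P[/eqP|//]]; rewrite (negPf yx).
have := leq_card_rank (indepS iJ (subD1set J x)) sJ.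
by have := cardsD1 x J; case: (x \in J) => /=; rank_lia.
Qed.

(** A larger independent set inside [A :|: C] would augment a basis of [A] by some [x], and then
    [x |: A] alone would already have larger rank than [A]. *)
Lemma rank_absorb A C :
  (forall x, x \in C -> rank_of M (x |: A) = rank_of M A) ->
  rank_of M (A :|: C) = rank_of M A.
Proof.
move=> abs; apply/eqP; rewrite eqn_leq (rankS (subsetUl _ _)) andbT leqNgt.
apply/negP => lt_AC; have [B [iB sBA cB]] := rank_basis A.
have [J [iJ sJ cJ]] := rank_basis (A :|: C).
have [|x /setDP[xJ xB] ixB] := indep_augment iB iJ; first by rewrite cB cJ.
have le_x : rank_of M (x |: A) <= rank_of M A.
  have /setUP[xA|/abs-> //] := subsetP sJ x xJ.
  by rewrite (setUidPr _) // sub1set.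
have := leq_card_rank ixB (setUS [set x] sBA).
by rewrite cardsU1 xB cB; rank_lia.
Qed.

(** Independent sets lie in the ground set. Ranks can thus be taken of any subset of the carrier, in
    particular ranks in [N1] and [N2] of flats of [N]. *)
Lemma rank_setI_ground A : rank_of M (A :&: ground M) = rank_of M A.
Proof.
apply/eqP; rewrite eqn_leq rankS ?subsetIl //=.
have [J [iJ sJA <-]] := rank_basis A.
by apply: leq_card_rank => //; rewrite subsetI sJA indep_ground.
Qed.

Lemma rank_le_mrank A : rank_of M A <= mrank M.
Proof. by rewrite -rank_setI_ground rankS ?subsetIr. Qed.

(** * Closure and flats *)

Lemma mem_mclosure x A :
  (x \in mclosure M A) = (x \in ground M) && (rank_of M (x |: A) == rank_of M A).
Proof. by rewrite inE. Qed.

Lemma mclosure_sub_ground A : mclosure M A \subset ground M.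
Proof. by apply/subsetP => x; rewrite inE => /andP[]. Qed.

Lemma sub_mclosure A : A :&: ground M \subset mclosure M A.
Proof.
apply/subsetP => x /setIP[xA xM].
by rewrite inE xM (setUidPr _) ?eqxx // sub1set.
Qed.

Lemma in_mclosure x A : x \in ground M -> x \in A -> x \in mclosure M A.
Proof. by move=> xM xA; rewrite (subsetP (sub_mclosure A)) // in_setI xA. Qed.

Lemma sub_ground_mclosure A : A \subset ground M -> A \subset mclosure M A.
Proof. by move/setIidPl=> {1}<-; exact: sub_mclosure. Qed.

Lemma rank_mclosure A : rank_of M (mclosure M A) = rank_of M A.
Proof.
apply/eqP; rewrite eqn_leq -[X in _ && (X <= _)]rank_setI_ground (rankS (sub_mclosure A)) andbT.
rewrite -(@rank_absorb A (mclosure M A)) ?rankS ?subsetUr // => x.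
by rewrite inE => /andP[_ /eqP].
Qed.

(** Extend a basis [I] of [A] to a basis [K] of [B]. If [x] raised the rank of [B], then [K] could
    be augmented, necessarily by [x]; so [x |: I] would be independent and [x] would raise the rank
    of [A] too. *)
Lemma mclosureS A B : A \subset B -> mclosure M A \subset mclosure M B.
Proof.
move=> sAB; apply/subsetP => x; rewrite !inE => /andP[-> /eqP rxA] /=.
rewrite eqn_leq (rankS (subsetUr _ _)) andbT leqNgt; apply/negP => lt_B.
have [I [iI sIA cI]] := rank_basis A.
have [K [iK sIK sKB cK]] := basis_extend iI (subset_trans sIA sAB).
have [J [iJ sJ cJ]] := rank_basis (x |: B).
have [|y /setDP[yJ yK] iyK] := indep_augment iK iJ; first by rewrite cK cJ.
have /setU1P[eyx | yB] := subsetP sJ y yJ; last first.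
  have := @leq_card_rank (y |: K) B iyK.
  by rewrite subUset sub1set yB sKB cardsU1 yK; rank_lia.
rewrite eyx in yK iyK.
have := leq_card_rank (indepS iyK (setUS [set x] sIK)) (setUS [set x] sIA).
by rewrite rxA cardsU1 (contra (subsetP sIK x) yK) cI; rank_lia.
Qed.

Lemma mclosure_flat A : mclosure M A \in flats M.
Proof.
rewrite inE mclosure_sub_ground eqEsubset sub_ground_mclosure ?mclosure_sub_ground //.
rewrite andbT; apply/subsetP => x; rewrite !mem_mclosure => /andP[xM /eqP rx].
rewrite xM eqn_leq (rankS (subsetUr _ _)) andbT.
rewrite -(rank_mclosure A) -rx -(rank_setI_ground (x |: A)) rankS //.
rewrite setIUl subUset subIset ?subsetUl //=.
exact: subset_trans (sub_mclosure A) (subsetUr _ _).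
Qed.

Lemma flat_sub_ground F : F \in flats M -> F \subset ground M.
Proof. by rewrite inE => /andP[]. Qed.

Lemma mclosure_id F : F \in flats M -> mclosure M F = F.
Proof. by rewrite inE => /andP[_ /eqP]. Qed.

Lemma flatP F : F \subset ground M -> mclosure M F \subset F -> F \in flats M.
Proof. by move=> sF scF; rewrite inE sF eqEsubset scF sub_ground_mclosure. Qed.

Lemma mclosure_sub_flat A F : F \in flats M -> A \subset F -> mclosure M A \subset F.
Proof. by move=> fF /mclosureS; rewrite (mclosure_id fF). Qed.

Lemma ground_flat : ground M \in flats M.
Proof. by apply: flatP => //; exact: mclosure_sub_ground. Qed.

Lemma flatI F G : F \in flats M -> G \in flats M -> F :&: G \in flats M.
Proof.
move=> fF fG; apply: flatP; first by rewrite subIset ?flat_sub_ground.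
by rewrite subsetI !mclosure_sub_flat ?subsetIl ?subsetIr.
Qed.

Lemma flat_eq F G : F \in flats M -> G \in flats M -> F \subset G ->
  rank_of M G <= rank_of M F -> F = G.
Proof.
move=> fF fG sFG le_GF; apply/eqP; rewrite eqEsubset sFG /=.
apply/subsetP => x xG; rewrite -(mclosure_id fF) mem_mclosure.
rewrite (subsetP (flat_sub_ground fG)) // eqn_leq (rankS (subsetUr _ _)) andbT.
by apply: leq_trans le_GF; rewrite rankS // subUset sub1set xG.
Qed.

Lemma flat_rank_lt F G : F \in flats M -> G \in flats M -> F \subset G ->
  F != G -> rank_of M F < rank_of M G.
Proof.
by move=> fF fG sFG; apply: contraNltn => /(flat_eq fF fG sFG)->.
Qed.

Lemma rank_setU1 x F : F \in flats M -> x \in ground M -> x \notin F ->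
  rank_of M (x |: F) = (rank_of M F).+1.
Proof.
move=> fF xM; rewrite -{1}(mclosure_id fF) mem_mclosure xM /= => neq.
have := rank_setU1_le x F; have := rankS (subsetUr [set x] F); rank_lia.
Qed.

(** A point outside a flat raises its rank by exactly one, so maximality forces the closure of
    [x |: F] to be the whole ground set. The successor form avoids truncated subtraction. *)
Lemma coatomsP F :
  reflect (F \in flats M /\ (rank_of M F).+1 = mrank M) (F \in coatoms M).
Proof.
rewrite [F \in coatoms M]in_set; apply: (iffP maxsetP) => [[/andP[/= fF pF] maxF] | [fF rF]].
  split=> //; have [_ [x xM xF]] := properP pF.
  rewrite -(rank_setU1 fF xM xF) -rank_mclosure.
  have sF : F \subset mclosure M (x |: F).
    by rewrite -{1}(mclosure_id fF) mclosureS ?subsetUr.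
  have xc : x \in mclosure M (x |: F) by rewrite in_mclosure ?setU11.
  rewrite /mrank; congr (rank_of M _).
  have := mclosure_sub_ground (x |: F); rewrite subEproper => /predU1P[// | pc].
  by move: xF; rewrite -(maxF _ _ sF) ?xc //= mclosure_flat.
split=> [|G /andP[/= fG pG] sFG]; rewrite /= ?fF.
  rewrite properEneq flat_sub_ground // andbT.
  by apply/eqP => eF; move: rF; rewrite /mrank -eF; rank_lia.
apply/esym/flat_eq => //; rewrite -ltnS rF.
by apply: flat_rank_lt (ground_flat) _ _; rewrite ?proper_neq // proper_sub.
Qed.

Lemma rank1_nonloop x : x \in ground M -> x \notin mclosure M set0 ->
  rank_of M [set x] = 1.
Proof.
move=> xM; rewrite mem_mclosure xM setU0 rank0 /= -lt0n => r_gt0.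
by apply/eqP; rewrite eqn_leq r_gt0 andbT -(cards1 x) rank_le_card.
Qed.

Lemma atomsP F : reflect (F \in flats M /\ rank_of M F = 1) (F \in atoms M).
Proof.
have r0 : rank_of M (mclosure M set0) = 0 by rewrite rank_mclosure rank0.
rewrite [F \in atoms M]in_set; apply: (iffP minsetP) => [[/andP[/= fF pF] minF] | [fF rF]].
  split=> //; have [_ [x xF x0]] := properP pF.
  have xM := subsetP (flat_sub_ground fF) x xF.
  rewrite -(minF (mclosure M [set x])).
  - by rewrite rank_mclosure rank1_nonloop.
  - rewrite /= mclosure_flat properE mclosureS ?sub0set //=.
    by apply: contra x0 => /subsetP->; rewrite ?in_mclosure ?set11.
  - by rewrite mclosure_sub_flat // sub1set.
split=> [|G /andP[/= fG pG] sGF]; rewrite /= ?fF.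
  rewrite properEneq mclosure_sub_flat ?sub0set // andbT.
  by apply/eqP => eF; move: rF; rewrite -eF r0.
apply: flat_eq => //; rewrite rF -r0.
by apply: flat_rank_lt; rewrite ?mclosure_flat ?proper_neq ?proper_sub.
Qed.

(** A flat is the join of its atoms: a nonloop lies in the atom it spans, and loops lie in every
    flat. *)
Lemma flat_sub_atoms F G : F \in flats M -> G \in flats M ->
  (forall A, A \in atoms M -> A \subset F -> A \subset G) -> F \subset G.
Proof.
move=> fF fG sub; apply/subsetP => x xF.
have xM := subsetP (flat_sub_ground fF) x xF.
have xc : x \in mclosure M [set x] by rewrite in_mclosure ?set11.
have [x0 | x0] := boolP (x \in mclosure M set0).
  by apply: (subsetP (mclosure_sub_flat fG _)) x0; rewrite sub0set.
apply: (subsetP (sub (mclosure M [set x]) _ _)) => //; last first.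
  by rewrite mclosure_sub_flat // sub1set.
by apply/atomsP; split; rewrite ?mclosure_flat // rank_mclosure rank1_nonloop.
Qed.

End Rank.

(** * Restrictions and direct sums *)

Section Restriction.
Variables (T : finType) (M : matroid T) (E : {set T}).
Implicit Types I J : {set T}.

Definition restr_indep := [set I in indep M | I \subset E].

Lemma restr_indep_ground I : I \in restr_indep -> I \subset ground M :&: E.
Proof. by rewrite inE subsetI => /andP[/indep_ground-> ->]. Qed.

Lemma restr_indep0 : set0 \in restr_indep.
Proof. by rewrite inE indep0 sub0set. Qed.

Lemma restr_indepS I J : J \in restr_indep -> I \subset J -> I \in restr_indep.
Proof.
by rewrite !inE => /andP[iJ sJ] sIJ; rewrite (indepS iJ) // (subset_trans sIJ).
Qed.

Lemma restr_indep_augment I J : I \in restr_indep -> J \in restr_indep ->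
  #|I| < #|J| -> exists2 x, x \in J :\: I & x |: I \in restr_indep.
Proof.
rewrite !inE => /andP[iI sI] /andP[iJ sJ] /(indep_augment iI iJ)[x xJI ixI].
exists x => //; rewrite inE ixI subUset sub1set sI andbT (subsetP sJ) //.
by case/setDP: xJI.
Qed.

Definition restr :=
  Matroid restr_indep_ground restr_indep0 restr_indepS restr_indep_augment.

Lemma restr_submatroid : submatroid restr M.
Proof.
split; first exact: subsetIl.
apply/setP => I; rewrite !inE subsetI.
by case iI : (I \in indep M); rewrite // (indep_ground iI).
Qed.

End Restriction.

Section Submatroid.
Variables (T : finType) (M M1 : matroid T).
Hypothesis subM1 : submatroid M1 M.
Implicit Types (A F : {set T}).

Lemma submatroid_rank A : rank_of M1 A = rank_of M (A :&: ground M1).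
Proof.
have [_ eqI] := subM1; apply/eqP; rewrite eqn_leq; apply/andP; split.
  have [J [iJ sJA <-]] := rank_basis M1 A.
  apply: leq_card_rank; last by rewrite subsetI sJA (indep_ground iJ).
  by move: iJ; rewrite eqI inE => /andP[].
have [J [iJ sJA <-]] := rank_basis M (A :&: ground M1).
move: sJA; rewrite subsetI => /andP[sJA sJ1].
by apply: leq_card_rank; rewrite // eqI inE iJ.
Qed.

Lemma submatroid_rank_sub A : A \subset ground M1 -> rank_of M1 A = rank_of M A.
Proof. by move=> sA; rewrite submatroid_rank (setIidPl sA). Qed.

Lemma submatroid_mclosure A : A \subset ground M1 ->
  mclosure M1 A = mclosure M A :&: ground M1.
Proof.
move=> sA; apply/setP => x; rewrite in_setI !mem_mclosure andbC [RHS]andbC.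
have [xM1 | //] := boolP (x \in ground M1); last by rewrite !andbF.
rewrite (subsetP subM1.1) //= !submatroid_rank_sub ?andbT //.
by rewrite subUset sub1set xM1.
Qed.

Lemma submatroid_flat F : F \in flats M -> F :&: ground M1 \in flats M1.
Proof.
move=> fF; apply: flatP; first exact: subsetIr.
by rewrite submatroid_mclosure ?subsetIr // setSI // mclosure_sub_flat ?subsetIl.
Qed.

(** The trace of [F] on [ground M1] is a flat of [M1] of full rank, hence all of [ground M1]. *)
Lemma flat_full_rank F : F \in flats M -> mrank M1 <= rank_of M1 F ->
  ground M1 \subset F.
Proof.
move=> fF full; rewrite -(@flat_eq _ M1 (F :&: ground M1) (ground M1)) ?subsetIl //.
- exact: submatroid_flat.
- exact: ground_flat.
- exact: subsetIr.
- by rewrite rank_setI_ground.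
Qed.

Lemma submatroid_loopless : loopless M -> loopless M1.
Proof.
move=> llM x xM1; have [sM1 ->] := subM1.
by rewrite inE llM ?(subsetP sM1) // sub1set.
Qed.

End Submatroid.

(** * Direct sums *)

Section DirectSum.
Variable T : finType.
Implicit Types (M : matroid T) (A F : {set T}).

Lemma direct_sumC M M1 M2 : is_direct_sum M M1 M2 -> is_direct_sum M M2 M1.
Proof.
case=> dis eqG eqI; split; rewrite 1?disjoint_sym 1?setUC //.
by rewrite eqI; apply/setP => I; apply/imset2P/imset2P => -[I1 I2 iI1 iI2 ->];
  exists I2 I1; rewrite // setUC.
Qed.

Lemma direct_sum_submatroid M M1 M2 : is_direct_sum M M1 M2 -> submatroid M1 M.
Proof.
case=> dis eqG eqI; split; first by rewrite eqG subsetUl.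
apply/setP => I; rewrite inE eqI; apply/idP/andP => [iI | [/imset2P[I1 I2 iI1 iI2 ->]]].
  split; last exact: indep_ground.
  by apply/imset2P; exists I set0; rewrite ?setU0 ?indep0.
rewrite subUset => /andP[_ sI2]; suff -> : I2 = set0 by rewrite setU0.
apply/eqP; rewrite -subset0 -(disjoint_setI0 dis).
by rewrite subsetI sI2 (indep_ground iI2).
Qed.

Lemma direct_sum_rank M M1 M2 A : is_direct_sum M M1 M2 ->
  rank_of M A = rank_of M1 A + rank_of M2 A.
Proof.
case=> dis eqG eqI; apply/eqP; rewrite eqn_leq; apply/andP; split.
  have [I [iI sIA <-]] := rank_basis M A.
  move: iI sIA; rewrite eqI => /imset2P[I1 I2 iI1 iI2 ->].
  rewrite subUset => /andP[sI1 sI2].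
  by rewrite (leq_trans (leq_card_setU _ _)) // leq_add ?leq_card_rank.
have [I1 [iI1 sI1 <-]] := rank_basis M1 A.
have [I2 [iI2 sI2 <-]] := rank_basis M2 A.
have dI : I1 :&: I2 = set0.
  apply/eqP; rewrite -subset0 -(disjoint_setI0 dis).
  by rewrite setISS ?indep_ground.
have <- : #|I1 :|: I2| = #|I1| + #|I2| by rewrite cardsU dI cards0 subn0.
apply: leq_card_rank; last by rewrite subUset sI1.
by rewrite eqI; apply/imset2P; exists I1 I2.
Qed.

Lemma direct_sum_mrank M M1 M2 : is_direct_sum M M1 M2 ->
  mrank M = mrank M1 + mrank M2.
Proof.
move=> ds; have [_ eqG _] := ds; rewrite /mrank (direct_sum_rank _ ds).
rewrite -[in LHS](rank_setI_ground M1) -[in LHS](rank_setI_ground M2) eqG.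
by rewrite setUK [_ :|: ground M2]setUC setUK.
Qed.

(** Bases [B1], [B2] of the two parts together span [M] and have at most [mrank M] elements, so
    their union is independent, and so are all unions of subsets of [B1] and [B2]. *)
Lemma direct_sum_of_rank M M1 M2 :
  submatroid M1 M -> submatroid M2 M ->
  [disjoint ground M1 & ground M2] -> ground M = ground M1 :|: ground M2 ->
  mrank M1 + mrank M2 <= mrank M -> is_direct_sum M M1 M2.
Proof.
move=> sub1 sub2 dis eqG le_r; split=> //; apply/setP => I; apply/idP/imset2P.
  move=> iI; exists (I :&: ground M1) (I :&: ground M2).
  - by rewrite sub1.2 inE subsetIr (indepS iI) ?subsetIl.
  - by rewrite sub2.2 inE subsetIr (indepS iI) ?subsetIl.
  - by rewrite -setIUr -eqG (setIidPl (indep_ground iI)).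
case=> I1 I2 iI1 iI2 ->.
have [B1 [iB1 sI1 sB1 cB1]] := basis_extend iI1 (indep_ground iI1).
have [B2 [iB2 sI2 sB2 cB2]] := basis_extend iI2 (indep_ground iI2).
apply: (@indepS _ _ _ (B1 :|: B2)); last by rewrite setUSS.
apply: indep_rank; apply: leq_trans (leq_card_setU _ _) _.
rewrite cB1 cB2 (leq_trans le_r) // -(rank_mclosure M (B1 :|: B2)) rankS //.
have span (M' : matroid T) (B : {set T}) : submatroid M' M -> B \in indep M' ->
    #|B| = mrank M' -> B \subset B1 :|: B2 ->
    ground M' \subset mclosure M (B1 :|: B2).
  move=> sub' iB cB sB; apply: (flat_full_rank sub'); rewrite ?mclosure_flat //.
  rewrite -cB leq_card_rank //; apply: subset_trans sB _.
  rewrite sub_ground_mclosure // subUset.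
  by rewrite (subset_trans sB1 sub1.1) (subset_trans sB2 sub2.1).
by rewrite eqG subUset (span M1 B1) ?(span M2 B2) ?subsetUl ?subsetUr.
Qed.

(** [F] has rank 0 in [M2], so a point of [M2], being a nonloop, raises the rank of [F]. Loops of
    [M2] would belong to every flat of [M]. *)
Lemma direct_sum_flat M M1 M2 F : is_direct_sum M M1 M2 -> loopless M2 ->
  F \in flats M1 -> F \in flats M.
Proof.
move=> ds ll2 fF; have [dis eqG _] := ds; have sF := flat_sub_ground fF.
apply: flatP; first by rewrite eqG subsetU ?sF.
apply/subsetP => x; rewrite mem_mclosure !(direct_sum_rank _ ds) => /andP[xM /eqP rx].
have le1 := rankS M1 (subsetUr [set x] F); have le2 := rankS M2 (subsetUr [set x] F).
rewrite -(mclosure_id fF) mem_mclosure.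
move: xM; rewrite eqG => /setUP[-> | x2] /=; first by apply/eqP; rank_lia.
have F2 : rank_of M2 F = 0.
  rewrite -rank_setI_ground; suff -> : F :&: ground M2 = set0 by rewrite rank0.
  by apply/eqP; rewrite -subset0 -(disjoint_setI0 dis) setSI.
have := leq_card_rank (ll2 x x2) (subsetUl [set x] F).
by rewrite cards1; rank_lia.
Qed.

End DirectSum.

(** * Adjoints *)

Section Adjoint.
Variables (T U : finType) (M : matroid T) (N : matroid U).
Variable phi : {set T} -> {set U}.
Hypothesis rNM : mrank N = mrank M.
Hypothesis phi_flat : forall F, F \in flats M -> phi F \in flats N.
Hypothesis phi_inj : {in flats M &, injective phi}.
Hypothesis phi_anti :
  {in flats M &, forall F G : {set T}, F \subset G -> phi G \subset phi F}.
Hypothesis phi_coatoms : phi @: coatoms M = atoms N.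
Implicit Types (F G K : {set T}) (e x : T).

Lemma phi_rank_lt F G : F \in flats M -> G \in flats M -> F \subset G ->
  F != G -> rank_of N (phi G) < rank_of N (phi F).
Proof.
move=> fF fG sFG neqFG; apply: flat_rank_lt; rewrite ?phi_flat ?phi_anti //.
by apply: contra neqFG => /eqP/phi_inj->.
Qed.

(** Climb from [F] to the ground set one rank at a time: each step strictly lowers the rank of the
    image. *)
Lemma phi_rank_ge F : F \in flats M -> mrank M <= rank_of N (phi F) + rank_of M F.
Proof.
have [n] := ubnP (mrank M - rank_of M F); elim: n F => // n IHn F le_n fF.
have [sMF | ] := boolP (ground M \subset F).
  by rewrite (leq_trans (rankS M sMF)) ?leq_addl.
case/subsetPn => x xM xF; have rx := rank_setU1 fF xM xF.
have fG := mclosure_flat M (x |: F); have rG := rank_mclosure M (x |: F).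
have sFG : F \subset mclosure M (x |: F).
  by rewrite -{1}(mclosure_id fF) mclosureS ?subsetUr.
have neqFG : F != mclosure M (x |: F) by apply/eqP => eFG; rewrite -eFG in rG; rank_lia.
have := phi_rank_lt fF fG sFG neqFG; have := rank_le_mrank M (x |: F).
by have := IHn _ _ fG; rewrite rG rx; rank_lia.
Qed.

(** Dually, removing the elements of [I] one by one strictly raises the rank of the image, which
    never exceeds [mrank N = mrank M]. *)
Lemma phi_rank_closure_le I : I \in indep M ->
  rank_of N (phi (mclosure M I)) + #|I| <= mrank M.
Proof.
have [n] := ubnP #|I|; elim: n I => // n IHn I le_n iI.
have [-> | [x xI]] := set_0Vmem I; first by rewrite cards0 addn0 -rNM rank_le_mrank.
have iJ := indepS iI (subD1set I x); have cI := cardsD1 x I.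
have rI := rank_indep iI; have rJ := rank_indep iJ.
rewrite xI in cI; have := IHn _ _ iJ.
suff : rank_of N (phi (mclosure M I)) < rank_of N (phi (mclosure M (I :\ x))) by rank_lia.
apply: phi_rank_lt; rewrite ?mclosure_flat ?mclosureS ?subD1set //.
apply/eqP => /(congr1 (rank_of M)); rewrite !rank_mclosure; rank_lia.
Qed.

Lemma phi_rank F : F \in flats M -> rank_of N (phi F) + rank_of M F = mrank M.
Proof.
move=> fF; apply/eqP; rewrite eqn_leq phi_rank_ge // andbT.
have [B [iB sBF cB]] := rank_basis M F.
have -> : F = mclosure M B.
  apply/esym/(@flat_eq _ M); rewrite ?mclosure_flat ?mclosure_sub_flat //.
  by rewrite rank_mclosure -cB rank_indep.
by rewrite rank_mclosure (rank_indep iB) phi_rank_closure_le.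
Qed.

(* Downward induction on [K]: for [K'] covering [K] inside [G], the flats
   [phi K'] and [phi (cl (e |: K))] have the same rank and, if the claim fails
   for [K], both are the join of [phi G] and [phi (cl (e |: K'))]. *)
Lemma phi_not_sub K G e : K \in flats M -> G \in flats M -> K \subset G ->
  e \in ground M -> e \notin G -> ~~ (phi G \subset phi (mclosure M (e |: K))).
Proof.
move=> + fG + eM eG.
have [n] := ubnP (rank_of M G - rank_of M K); elim: n K => // n IHn K le_n fK sKG.
apply/negP => sub.
have eK : e \notin K by apply: contra eG; apply: subsetP.
have fKe := mclosure_flat M (e |: K).
have := phi_rank fKe; rewrite rank_mclosure (rank_setU1 fK eM eK) => rKe.
have [sGK | ] := boolP (G \subset K).
  have eKG : K = G by apply/eqP; rewrite eqEsubset sKG.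
  by have := rankS N sub; have := phi_rank fG; rewrite -eKG; rank_lia.
case/subsetPn => p pG pK; have pM := subsetP (flat_sub_ground fG) p pG.
pose K' := mclosure M (p |: K).
have fK' : K' \in flats M by apply: mclosure_flat.
have sK'G : K' \subset G by rewrite mclosure_sub_flat // subUset sub1set pG.
have sKK' : K \subset K' by rewrite -{1}(mclosure_id fK) mclosureS ?subsetUr.
have eK' : e \notin K' by apply: contra eG; apply: subsetP.
have rK' : rank_of M K' = (rank_of M K).+1 by rewrite rank_mclosure rank_setU1.
have fK'e := mclosure_flat M (e |: K').
have := phi_rank fK'e; rewrite rank_mclosure (rank_setU1 fK' eM eK') => rK'e.
have nsub : ~~ (phi G \subset phi (mclosure M (e |: K'))).
  by apply: IHn => //; have := rankS M sK'G; rank_lia.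
have sub1 : phi (mclosure M (e |: K')) \subset phi (mclosure M (e |: K)).
  by rewrite phi_anti // mclosureS // setUS.
have sub2 : phi (mclosure M (e |: K')) \subset phi K'.
  by rewrite phi_anti // -{1}(mclosure_id fK') mclosureS ?subsetUr.
(* With [k = rank_of M K] and [r = mrank M], both flats met here have rank [r - k - 1], while
   [phi (mclosure M (e |: K'))] has rank [r - k - 2]. As [P] contains the latter and also [phi G],
   it is strictly larger, so it equals both flats. *)
pose P := phi (mclosure M (e |: K)) :&: phi K'.
have fP : P \in flats N by rewrite flatI ?phi_flat.
have rP : rank_of N (phi (mclosure M (e |: K'))) < rank_of N P.
  apply: flat_rank_lt; rewrite ?phi_flat ?subsetI ?sub1 ?sub2 //.
  by apply: contra nsub => /eqP->; rewrite subsetI sub phi_anti.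
have rphiK' := phi_rank fK'.
have eP1 : P = phi (mclosure M (e |: K)).
  by apply: (flat_eq fP); rewrite ?phi_flat ?subsetIl //; rank_lia.
have eP2 : P = phi K' by apply: (flat_eq fP); rewrite ?phi_flat ?subsetIr //; rank_lia.
have eqK : mclosure M (e |: K) = K' by apply: phi_inj; rewrite // -eP1.
by case/negP: eK'; rewrite -eqK in_mclosure ?setU11.
Qed.

(** For a point [e] of [F] outside [G], the inclusion would put [phi G] below the image of the flat
    spanned by [e] and the loops, against [phi_not_sub] with [K] the bottom flat. *)
Lemma phi_reflect F G : F \in flats M -> G \in flats M ->
  phi G \subset phi F -> F \subset G.
Proof.
move=> fF fG sub; apply/subsetP => e eF; apply/negPn/negP => eG.
have eM := subsetP (flat_sub_ground fF) e eF.
have f0 := mclosure_flat M set0.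
have s0 H : H \in flats M -> mclosure M set0 \subset H.
  by move=> fH; rewrite mclosure_sub_flat ?sub0set.
case/negP: (phi_not_sub f0 fG (s0 G fG) eM eG); apply: subset_trans sub _.
by rewrite phi_anti ?mclosure_flat ?mclosure_sub_flat // subUset sub1set eF s0.
Qed.

(* Every atom of [N] is [phi H] for a hyperplane [H], and by [phi_reflect] it
   lies below [phi (cl x)] exactly when [x \in H]. *)
Lemma phi_meet (A : {set T}) (P : {set U}) : A \subset ground M -> P \in flats N ->
  (forall x, x \in A -> P \subset phi (mclosure M [set x])) ->
  P \subset phi (mclosure M A).
Proof.
move=> sA fP sub; apply: (@flat_sub_atoms _ N); rewrite ?phi_flat ?mclosure_flat // => B.
rewrite -phi_coatoms => /imsetP[H /coatomsP[fH _] ->] sHP.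
apply: phi_anti; rewrite ?mclosure_flat // mclosure_sub_flat //.
apply/subsetP => x xA; have xM := subsetP sA x xA.
have sx : mclosure M [set x] \subset H.
  by rewrite phi_reflect ?mclosure_flat // (subset_trans sHP) ?sub.
by rewrite (subsetP sx) // in_mclosure ?set11.
Qed.

(** The indices cross: [E = ground N2] yields the ground set of the summand matched with [N1], and
    conversely. *)
Definition points_over (E : {set U}) :=
  [set x in ground M | E \subset phi (mclosure M [set x])].

Lemma points_over_phi (A : {set T}) (E : {set U}) : E \subset ground N ->
  A \subset points_over E -> E \subset phi (mclosure M A).
Proof.
move=> sE sA; apply: subset_trans (sub_ground_mclosure sE) _.
apply: phi_meet; rewrite ?mclosure_flat //.
  by apply/subsetP => x /(subsetP sA); rewrite inE => /andP[].
move=> x /(subsetP sA); rewrite inE => /andP[_ sEx].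
by rewrite mclosure_sub_flat ?phi_flat ?mclosure_flat.
Qed.

(** * Splitting [M] along the summands of [N] *)

Section Summands.
Variables N1 N2 : matroid U.
Hypothesis dsN : is_direct_sum N N1 N2.

Let subN1 : submatroid N1 N := direct_sum_submatroid dsN.
Let subN2 : submatroid N2 N := direct_sum_submatroid (direct_sumC dsN).

(** The image of the closure of these points contains [ground N2], so its rank is at least
    [mrank N2]; by [phi_rank] at most [mrank N1] is left for the points themselves. *)
Lemma points_over_rank : rank_of M (points_over (ground N2)) <= mrank N1.
Proof.
have := rankS N2 (points_over_phi subN2.1 (subxx (points_over (ground N2)))).
have := phi_rank (mclosure_flat M (points_over (ground N2))).
rewrite rank_mclosure (direct_sum_rank _ dsN) -rNM (direct_sum_mrank dsN).
rewrite -/(mrank N2); rank_lia.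
Qed.

Hypothesis llM : loopless M.

Lemma phi_point_rank x : x \in ground M ->
  (rank_of N (phi (mclosure M [set x]))).+1 = mrank N.
Proof.
move=> xM; have := phi_rank (mclosure_flat M [set x]).
by rewrite rank_mclosure (rank_indep (llM xM)) cards1 addn1 rNM.
Qed.

Lemma points_over_disjoint :
  [disjoint points_over (ground N2) & points_over (ground N1)].
Proof.
rewrite -setI_eq0; apply/eqP/setP => x; rewrite in_set0; apply/negP.
case/setIP; rewrite !inE => /andP[xM s2] /andP[_ s1].
have [_ eqG _] := dsN; have := phi_point_rank xM.
have : ground N \subset phi (mclosure M [set x]) by rewrite eqG subUset s1.
by move/(rankS N); rewrite -/(mrank N); rank_lia.
Qed.

(** The ranks of a hyperplane of [N] in [N1] and [N2] add up to one less than the total, so one of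
    them is full, and the hyperplane contains that summand. *)
Lemma points_over_cover :
  ground M = points_over (ground N2) :|: points_over (ground N1).
Proof.
apply/setP => x; rewrite in_setU !inE -andb_orr.
have [xM | //] := boolP (x \in ground M); apply/esym/orP.
have fx := phi_flat (mclosure_flat M [set x]).
have := phi_point_rank xM; rewrite (direct_sum_rank _ dsN) (direct_sum_mrank dsN).
have [full1 _ | lt1 eqr] := leqP (mrank N1) (rank_of N1 (phi (mclosure M [set x]))).
  by right; apply: flat_full_rank fx full1.
by left; apply: (flat_full_rank subN2 fx); rank_lia.
Qed.

Variables M1 M2 : matroid T.
Hypothesis dsM : is_direct_sum M M1 M2.
Hypothesis gM1 : ground M1 = points_over (ground N2).
Hypothesis rM1 : mrank M1 = mrank N1.
Hypothesis rM2 : mrank M2 = mrank N2.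

Let subM1 : submatroid M1 M := direct_sum_submatroid dsM.
Let subM2 : submatroid M2 M := direct_sum_submatroid (direct_sumC dsM).

Let flatM F : F \in flats M1 -> F \in flats M.
Proof. exact: direct_sum_flat dsM (submatroid_loopless subM2 llM). Qed.

Lemma phi_over F : F \in flats M1 -> ground N2 \subset phi F.
Proof.
move=> fF; rewrite -(mclosure_id (flatM fF)) points_over_phi ?subN2.1 //.
by rewrite -gM1 flat_sub_ground.
Qed.

Lemma phi_summand_rank F : F \in flats M1 ->
  rank_of N1 (phi F) + rank_of M1 F = mrank M1.
Proof.
move=> fF; have := phi_rank (flatM fF).
rewrite -rNM (direct_sum_rank _ dsN) (direct_sum_mrank dsN).
rewrite (submatroid_rank_sub subM1 (flat_sub_ground fF)).
have := rankS N2 (phi_over fF); have := rank_le_mrank N2 (phi F).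
rewrite -/(mrank N2); rank_lia.
Qed.

(** Only [ground M1] is tied to [points_over], so that exchanging the indices gives the statement
    for the second summand. *)
Lemma adjoint_summand : adjoint M1 N1.
Proof.
split=> //; exists (fun F => phi F :&: ground N1); split.
- by move=> F fF; rewrite (submatroid_flat subN1) ?phi_flat ?flatM.
- move=> F G fF fG eqFG; apply: phi_inj; rewrite ?flatM //.
  (* The trace on [N1] determines [phi H], because [phi H] contains all of [ground N2]; hence the
     trace map is injective. *)
  have split_phi H : H \in flats M1 -> phi H = (phi H :&: ground N1) :|: ground N2.
    move=> fH; have [_ eqG _] := dsN.
    rewrite setUIl (setUidPl (phi_over fH)) -eqG.
    by apply/esym/setIidPl/flat_sub_ground/phi_flat/flatM.
  by rewrite (split_phi F) // (split_phi G) // eqFG.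
- by move=> F G fF fG sFG; rewrite setSI // phi_anti ?flatM.
apply/setP => A; apply/imsetP/atomsP => [[H /coatomsP[fH rH] ->] | [fA rA]].
  split; first by rewrite (submatroid_flat subN1) ?phi_flat ?flatM.
  by rewrite rank_setI_ground; have := phi_summand_rank fH; rank_lia.
have sA := flat_sub_ground fA.
(* An atom [A] of [N1] may fail to be a flat of [N], which can have loops in [N2]; its closure in
   [N] is an atom, hence the image of a hyperplane [H] of [M]. *)
have : mclosure N A \in atoms N.
  by apply/atomsP; rewrite mclosure_flat rank_mclosure -(submatroid_rank_sub subN1).
rewrite -phi_coatoms => /imsetP[H /coatomsP[fH rH] eqH].
have sAH : A \subset phi H.
  by rewrite -eqH sub_ground_mclosure // (subset_trans sA) ?subN1.1.
have fH1 := submatroid_flat subM1 fH.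
have sAH1 : A \subset phi (H :&: ground M1).
  by rewrite (subset_trans sAH) // phi_anti ?(flatM fH1) ?subsetIl.
have rH1 := phi_summand_rank fH1; rewrite rank_setI_ground in rH1.
have := rankS N1 sAH1; rewrite rA => r_gt0.
(* [H] has corank one in [M], so its trace has corank at most one in [M1]; the corank is not 0,
   since the image of the trace contains the rank one set [A]. *)
have r1 : (rank_of M1 H).+1 = mrank M1.
  have := rank_le_mrank M2 H.
  by move: rH; rewrite (direct_sum_rank _ dsM) (direct_sum_mrank dsM); rank_lia.
exists (H :&: ground M1); first by apply/coatomsP; rewrite rank_setI_ground.
apply: (@flat_eq _ N1) => //.
- by rewrite (submatroid_flat subN1) ?phi_flat ?flatM.
- by rewrite subsetI sAH1.
- by rewrite rA rank_setI_ground; rank_lia.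
Qed.

End Summands.

End Adjoint.

Theorem theorem3p3 (T U : finType) (M : matroid T) (N N1 N2 : matroid U) :
  nonempty M -> nonempty N1 -> nonempty N2 ->
  loopless M ->
  adjoint M N ->
  is_direct_sum N N1 N2 ->
  exists M1 M2 : matroid T,
    [/\ submatroid M1 M, submatroid M2 M, is_direct_sum M M1 M2,
        adjoint M1 N1 & adjoint M2 N2].
Proof.
move=> _ _ _ llM [rNM [phi [phi_flat phi_inj phi_anti phi_co]]] dsN.
have dsN' := direct_sumC dsN.
pose E1 := points_over M phi (ground N2); pose E2 := points_over M phi (ground N1).
have sub1 := restr_submatroid M E1; have sub2 := restr_submatroid M E2.
have gE (E : {set U}) : ground (restr M (points_over M phi E)) = points_over M phi E.
  by apply/setIidPr/subsetP => x; rewrite inE => /andP[].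
have r1 : mrank (restr M E1) <= mrank N1.
  by rewrite /mrank (submatroid_rank_sub sub1) // gE; apply: points_over_rank dsN.
have r2 : mrank (restr M E2) <= mrank N2.
  by rewrite /mrank (submatroid_rank_sub sub2) // gE; apply: points_over_rank dsN'.
have dis : [disjoint ground (restr M E1) & ground (restr M E2)].
  by rewrite !gE; apply: points_over_disjoint dsN llM.
have cov : ground M = ground (restr M E1) :|: ground (restr M E2).
  by rewrite !gE; apply: points_over_cover dsN llM.
have rN := direct_sum_mrank dsN.
have dsM : is_direct_sum M (restr M E1) (restr M E2).
  by apply: direct_sum_of_rank => //; rewrite -rNM rN leq_add.
have rM := direct_sum_mrank dsM.
(* The bounds [r1] and [r2] have equal sums on both sides, so both are equalities. *)
have e1 : mrank (restr M E1) = mrank N1 by rank_lia.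
have e2 : mrank (restr M E2) = mrank N2 by rank_lia.
exists (restr M E1), (restr M E2); split=> //.
  exact: (adjoint_summand rNM phi_flat phi_inj phi_anti phi_co dsN llM dsM (gE _) e1 e2).
exact: (adjoint_summand rNM phi_flat phi_inj phi_anti phi_co dsN' llM
  (direct_sumC dsM) (gE _) e2 e1).
Qed.
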